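(* For any graph $G$, $$\tilde{\chi}(G)\leq \tilde{\chi}_2(G)\leq \chi_{\mathrm{LC}}(G)\leq \chi(G).$$
   Context: Graphs are finite and simple, with vertex set $V=\{1,\dots,n\}$. The graph state $|G\rangle\in(\mathbb{C}^2)^{\otimes n}$ is the unique (up to phase) unit vector that is a common $+1$ eigenvector of $S_j=X_j\prod_{k:\{j,k\}\in E}Z_k$, $j=1,\dots,n$, with $X_j,Y_j,Z_j$ the Pauli matrices on qubit $j$. A complete Pauli measurement (setting) $\mu$ measures exactly one of $X,Y,Z$ on each qubit; its outcome projectors $\Pi_{\mu,\mathbf v}$, $\mathbf v\in\{0,1\}^n$, are tensor products of the projectors onto the eigenvectors with eigenvalue $(-1)^{v_j}$ of the Pauli operators measured on qubits $j=1,\dots,n$. A test operator based on $\mu$ is an operator $0\le E\le\mathbb{1}$ with $E|G\rangle=|G\rangle$ that is a linear combination of the $\Pi_{\mu,\mathbf v}$. The state $|G\rangle$ can be verified by a set of settings $\mathscr M$ if there is a convex combination $\Omega=\sum_{\mu\in\mathscr M}p_\mu E_\mu$ of test operators $E_\mu$ based on $\mu\in\mathscr M$ whose second largest eigenvalue (counted with multiplicity) is strictly less than $1$. $\tilde\chi(G)$ is the minimum number of settings in a set $\mathscr M$ that can verify $|G\rangle$. $\tilde\chi_2(G)$ is the minimum number under the restriction that on each qubit at most two of the three Pauli operators $X,Y,Z$ occur among the settings in $\mathscr M$ (the pair may depend on the qubit). $\chi(G)$ is the chromatic number. Local complementation at a vertex $j$ replaces the subgraph induced on the neighborhood of $j$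 by its complement; $\chi_{\mathrm{LC}}(G)$ is the minimum of $\chi(G')$ over all graphs $G'$ obtained from $G$ by finite sequences of local complementations. *)

(* Defs.v *)
From HB Require Import structures.
From mathcomp Require Import all_boot all_order all_algebra.
Set Implicit Arguments.
Unset Strict Implicit.
Unset Printing Implicit Defensive.
Import Order.TTheory GRing.Theory Num.Theory.
Local Open Scope ring_scope.
Local Open Scope sesquilinear_scope.

Definition is_minimum (P : nat -> Prop) (k : nat) : Prop :=
  P k /\ forall m, P m -> (k <= m)%N.

(* A graph on n vertices is a relation [e : rel 'I_n], which is assumed
   symmetric and irreflexive in the theorem; these two properties are
   preserved by [local_compl]. *)

Definition colorable n (e : rel 'I_n) (k : nat) : Prop :=
  exists c : 'I_n -> 'I_k, forall u v, e u v -> c u != c v.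

Definition is_chromatic_number n (e : rel 'I_n) (k : nat) : Prop :=
  is_minimum (colorable e) k.

Definition local_compl n (e : rel 'I_n) (j : 'I_n) : rel 'I_n :=
  fun u v => if [&& u != v, e j u & e j v] then ~~ e u v else e u v.

Definition is_chi_LC n (e : rel 'I_n) (k : nat) : Prop :=
  is_minimum (fun m => exists s : seq 'I_n,
    is_chromatic_number (foldl (@local_compl n) e s) m) k.

Inductive pauli := PX | PY | PZ.

Definition pauli_code (P : pauli) : 'I_3 :=
  match P with PX => inord 0 | PY => inord 1 | PZ => inord 2 end.
Definition pauli_decode (i : 'I_3) : pauli :=
  match val i with 0%N => PX | 1%N => PY | _ => PZ end.
Lemma pauli_codeK : cancel pauli_code pauli_decode.
Proof. by case; rewrite /pauli_decode /= inordK. Qed.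
HB.instance Definition _ := Countable.copy pauli (can_type pauli_codeK).
Lemma pauli_enumP : Finite.axiom [:: PX; PY; PZ].
Proof. by case; rewrite /= -!(inj_eq (can_inj pauli_codeK)) -!val_eqE /= !inordK. Qed.
HB.instance Definition _ := isFinite.Build pauli pauli_enumP.

Definition setting n := {ffun 'I_n -> pauli}.

Definition two_paulis_per_qubit n (M : {set setting n}) : bool :=
  [forall j : 'I_n, #|[set (mu : setting n) j | mu in M]| <= 2]%N.

Definition bits n := {ffun 'I_n -> 'I_2}.

(* The space of n qubits has the computational basis vectors indexed by
   bit strings; [enum_val] turns a matrix index into a bit string. *)
Notation qdim n := #|{: bits n}|.

Section Quantum.
Variable C : numClosedFieldType.

Definition mx2 (a b c d : C) : 'M[C]_2 :=
  \matrix_(i, j) if i == 0 then if j == 0 then a else b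
                           else if j == 0 then c else d.

Definition pauli_mx (P : pauli) : 'M[C]_2 :=
  match P with
  | PX => mx2 0 1 1 0
  | PY => mx2 0 (- 'i) 'i 0
  | PZ => mx2 1 0 0 (-1)
  end.

Definition tens n (A : 'I_n -> 'M[C]_2) : 'M[C]_(qdim n) :=
  \matrix_(r, c) \prod_(k < n) A k ((enum_val r : bits n) k)
                                   ((enum_val c : bits n) k).

Definition on_qubit n (j : 'I_n) (A : 'M[C]_2) : 'M[C]_(qdim n) :=
  tens (fun k => if k == j then A else 1%:M).

Definition stabilizer n (e : rel 'I_n) (j : 'I_n) : 'M[C]_(qdim n) :=
  on_qubit j (pauli_mx PX) * \prod_(k < n | e j k) on_qubit k (pauli_mx PZ).

Definition is_graph_state n (e : rel 'I_n) (psi : 'cV[C]_(qdim n)) : bool :=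
  (psi^t* *m psi == 1%:M) && [forall j : 'I_n, stabilizer e j *m psi == psi].

(* The projector onto the eigenspace of a Pauli matrix for the eigenvalue
   (-1) ^+ b. *)
Definition pauli_proj (P : pauli) (b : 'I_2) : 'M[C]_2 :=
  2^-1 *: (1%:M + (-1) ^+ b *: pauli_mx P).

Lemma pauli_projP (P : pauli) :
  [/\ forall b, pauli_mx P *m pauli_proj P b = (-1) ^+ b *: pauli_proj P b,
      forall b, (pauli_proj P b)^t* = pauli_proj P b &
      \sum_b pauli_proj P b = 1%:M].
Proof.
have ord2 (i : 'I_2) : i = 0 \/ i = 1.
  by case: i => [[|[|//]] ?]; [left | right]; apply: val_inj.
have n2 : (2 : C) != 0 by rewrite pnatr_eq0.
have ii : 'i * 'i = -1 :> C by rewrite -expr2 sqrCi.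
have sq : pauli_mx P *m pauli_mx P = 1%:M.
  apply/matrixP => i j; rewrite !mxE big_ord_recl big_ord1.
  by case: P; case: (ord2 i) => ->; case: (ord2 j) => ->; rewrite !mxE /=
    ?(mul0r, mulr0, mul1r, mulr1, addr0, add0r, mulNr, mulrN, ii, opprK, oppr0).
have herm : (pauli_mx P)^t* = pauli_mx P.
  apply/matrixP => i j; rewrite !mxE; clear sq.
  by case: P; case: (ord2 i) => ->; case: (ord2 j) => ->; rewrite !mxE /=
    ?(rmorphN, rmorph1, rmorph0, conjCi, opprK) //= ?conjCi ?opprK.
split=> [b|b|].
- rewrite /pauli_proj -scalemxAr mulmxDr mulmx1 -scalemxAr sq.
  rewrite [RHS]scalerA mulrC -[RHS]scalerA; congr (_ *: _).
  by rewrite scalerDr [in RHS]scalerA -expr2 sqrr_sign scale1r addrC.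
- rewrite /pauli_proj linearZ /= map_mxZ fmorphV rmorph_nat linearD linearZ /=.
  by rewrite map_mxD map_mxZ trmx1 map_mx1 rmorph_sign herm.
- rewrite big_ord_recl big_ord1 /pauli_proj -scalerDr expr0 expr1 scale1r.
  rewrite scaleN1r addrACA subrr addr0 -[X in X + X]scale1r -scalerDl scalerA.
  by rewrite mulVf ?scale1r.
Qed.

Definition outcome_proj n (mu : setting n) (v : bits n) : 'M[C]_(qdim n) :=
  tens (fun j => pauli_proj (mu j) (v j)).

(* Over C, a nonnegative quadratic form forces A to be Hermitian. *)
Definition psd N (A : 'M[C]_N) : Prop :=
  forall x : 'cV[C]_N, 0 <= (x^t* *m A *m x) 0 0.

Definition test_operator n (psi : 'cV[C]_(qdim n)) (mu : setting n)
    (E : 'M[C]_(qdim n)) : Prop :=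
  [/\ psd E, psd (1%:M - E), E *m psi = psi &
      exists c : bits n -> C, E = \sum_v c v *: outcome_proj mu v].

(* The eigenvalues are repeated according to multiplicity in [s]. *)
Definition is_second_largest_eigenvalue N (A : 'M[C]_N) (l : C) : Prop :=
  exists s : seq C, [/\ char_poly A = \prod_(a <- s) ('X - a%:P),
    sorted >=%R s, (1 < size s)%N & s`_1 = l].

Definition can_verify_state n (psi : 'cV[C]_(qdim n)) (M : {set setting n}) :
    Prop :=
  exists (p : setting n -> C) (E : setting n -> 'M[C]_(qdim n)) (l : C),
  [/\ forall mu, mu \in M -> 0 <= p mu,
      \sum_(mu in M) p mu = 1,
      forall mu, mu \in M -> test_operator psi mu (E mu),
      is_second_largest_eigenvalue (\sum_(mu in M) p mu *: E mu) l &
      l < 1].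

Section GraphStateExists.
Variables (n : nat) (e : rel 'I_n).
Hypotheses (e_sym : symmetric e) (e_irr : irreflexive e).

Let sgn (b : bool) : C := (-1) ^+ b.

Let amp (s : bits n) : C :=
  \prod_(a < n) \prod_(b < n) sgn [&& (a < b)%N, e a b, s a == 1 & s b == 1].

Let ket : 'cV[C]_(qdim n) := \col_r ((sqrtC (qdim n)%:R)^-1 * amp (enum_val r)).

Let bit_flip (j : 'I_n) (s : bits n) : bits n :=
  [ffun k => if k == j then s k + 1 else s k].

Let amp_flip j s :
  amp (bit_flip j s) = amp s * \prod_(k | e j k) sgn (s k == 1).
Proof.
pose g (a b : 'I_n) := sgn [&& a == j, (a < b)%N, e a b & s b == 1] *
              sgn [&& b == j, (a < b)%N, e a b & s a == 1].
have -> : amp (bit_flip j s) = amp s * \prod_a \prod_b g a b.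
  rewrite /amp -big_split; apply: eq_bigr => a _ /=.
  rewrite -big_split; apply: eq_bigr => b _ /=.
  rewrite /g /sgn -!signr_addb; congr (_ ^+ (nat_of_bool _)).
  rewrite !ffunE.
  have fl (x : 'I_2) : (x + 1 == 1) = ~~ (x == 1).
    by case: x => [[|[|//]] ?].
  case: (a =P j) => [->|_]; case: (b =P j) => [->|_]; rewrite ?ltnn ?fl //=;
  by case: (_ < _)%N; case: (e _ _); case: (s _ == 1); case: (s _ == 1).
congr (_ * _).
under eq_bigr do rewrite big_split /=.
rewrite big_split /= (bigD1 j) //= [X in _ * X * _]big1 ?mulr1; last first.
  by move=> a /negPf aj; apply: big1 => b _; rewrite aj.
rewrite exchange_big /= [X in _ * X](bigD1 j) //= [X in _ * (_ * X)]big1 ?mulr1; last first.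
  by move=> a /negPf aj; apply: big1 => b _; rewrite aj.
rewrite -big_split /= [RHS]big_mkcond; apply: eq_bigr => k _ /=.
rewrite eqxx /= (e_sym k j) /sgn -signr_addb.
case: ltngtP => [||/val_inj <-]; case: ifP => //=; last by rewrite e_irr.
by rewrite addbF.
Qed.

Let on_qubitE j A r c : @on_qubit n j A r c =
  let s : bits n := enum_val r in let t : bits n := enum_val c in
  if [forall k, (k != j) ==> (s k == t k)] then A (s j) (t j) else 0.
Proof.
rewrite mxE (bigD1 j) //= eqxx; case: ifP => [/forallP st|/forallPn[k]].
  rewrite big1 ?mulr1 // => k kj; rewrite (negPf kj) mxE.
  by have := st k; rewrite kj /= => ->.
rewrite negb_imply => /andP[kj /negPf st].
by rewrite [X in _ * X](bigD1 k) //= (negPf kj) mxE st mul0r mulr0.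
Qed.

Let on_qubitZ k (x : 'cV[C]_(qdim n)) r :
  (on_qubit k (pauli_mx PZ) *m x) r 0 =
  sgn ((enum_val r : bits n) k == 1) * x r 0.
Proof.
rewrite mxE (bigD1 r) //= [X in _ + X]big1 ?addr0; last first.
  move=> c cr; rewrite on_qubitE /=; case: ifP => [/forallP st|]; last first.
    by rewrite mul0r.
  rewrite mxE; case: (altP (enum_val r k =P enum_val c k)) => [eq|].
    case/eqP: cr; apply: enum_val_inj; apply/ffunP => l; apply/esym/eqP.
    by case: (eqVneq l k) (st l) => [-> _|//]; apply/eqP.
  by case: (enum_val r k) => [[|[|//]] ?];
     case: (enum_val c k) => [[|[|//]] ?]; rewrite //= mul0r.
rewrite on_qubitE /= ifT; last by apply/forallP => l; rewrite eqxx implybT.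
by rewrite mxE /sgn; case: (enum_val r k) => [[|[|//]] ?].
Qed.

Let on_qubitX k (x : 'cV[C]_(qdim n)) r :
  (on_qubit k (pauli_mx PX) *m x) r 0 =
  x (enum_rank (bit_flip k (enum_val r))) 0.
Proof.
set c0 := enum_rank _.
have c0E : enum_val c0 = bit_flip k (enum_val r) by rewrite enum_rankK.
rewrite mxE (bigD1 c0) //= [X in _ + X]big1 ?addr0; last first.
  move=> c cr; rewrite on_qubitE /=; case: ifP => [/forallP st|]; last first.
    by rewrite mul0r.
  rewrite mxE; case: (altP (enum_val c k =P enum_val r k + 1)) => [eq|].
    case/eqP: cr; apply: enum_val_inj; rewrite c0E; apply/ffunP => l.
    by rewrite ffunE; case: (eqVneq l k) (st l) => [->|_ /eqP].
  by case: (enum_val r k) => [[|[|//]] ?];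
     case: (enum_val c k) => [[|[|//]] ?]; rewrite //= mul0r.
rewrite on_qubitE /= c0E ifT; last first.
  by apply/forallP => l; apply/implyP => /negPf lk; rewrite ffunE lk.
by rewrite mxE ffunE eqxx; case: (enum_val r k) => [[|[|//]] ?];
  rewrite /= mul1r.
Qed.

Let prodZ (P : pred 'I_n) (x : 'cV[C]_(qdim n)) r :
  ((\prod_(k < n | P k) on_qubit k (pauli_mx PZ) : 'M_(qdim n)) *m x) r 0 =
  (\prod_(k | P k) sgn ((enum_val r : bits n) k == 1)) * x r 0.
Proof.
elim: (index_enum _) => [|k s IH]; first by rewrite !big_nil mul1mx mul1r.
rewrite !big_cons; case: ifP => // _.
by rewrite -mulmxA on_qubitZ IH mulrA.
Qed.

Lemma graph_state_exists : exists psi, is_graph_state e psi.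
Proof.
exists ket; apply/andP; split.
  apply/eqP/matrixP => i j; rewrite !mxE !ord1 eqxx.
  have N0 : (qdim n)%:R != 0 :> C.
    by rewrite pnatr_eq0 -lt0n; apply/card_gt0P; exists [ffun=> 0].
  have phase s : (amp s)^* * amp s = 1.
    rewrite /amp rmorph_prod -big_split big1 // => a _ /=.
    rewrite rmorph_prod -big_split big1 // => b _ /=.
    by rewrite /sgn rmorph_sign -signr_addb addbb.
  under eq_bigr => r _.
    rewrite !mxE rmorphM /= mulrACA phase mulr1 fmorphV /=.
    rewrite (conj_Creal (ger0_real _)) ?sqrtC_ge0 ?ler0n // -invfM -expr2 sqrtCK.
    over.
  by rewrite sumr_const card_ord -[LHS]mulr_natr mulVf.
apply/forallP => j; apply/eqP/matrixP => r z; rewrite (ord1 z) {z}.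
rewrite -mulmxA on_qubitX prodZ !mxE enum_rankK amp_flip.
rewrite mulrCA; congr (_ * _); rewrite mulrC -mulrA.
rewrite [X in _ * (_ * X)](eq_bigr (fun k => sgn ((enum_val r : bits n) k == 1))).
  rewrite -big_split big1 ?mulr1 // => k _ /=.
  by rewrite /sgn -signr_addb addbb.
by move=> k jk; rewrite ffunE; case: (k =P j) jk => [->|//]; rewrite e_irr.
Qed.

(* An arbitrary choice of the phase of |G>, on which [can_verify] below does
   not depend. *)
Definition graph_state : 'cV[C]_(qdim n) := xchoose graph_state_exists.

Lemma graph_stateP : is_graph_state e graph_state.
Proof. exact: xchooseP. Qed.

Definition can_verify (M : {set setting n}) : Prop :=
  can_verify_state graph_state M.

Definition is_chi_tilde (k : nat) : Prop :=
  is_minimum (fun m => exists2 M, can_verify M & #|M| = m) k.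

Definition is_chi_tilde2 (k : nat) : Prop :=
  is_minimum (fun m => exists2 M,
    can_verify M /\ two_paulis_per_qubit M & #|M| = m) k.

End GraphStateExists.
End Quantum.

(* Main.v *)
(* For a proper coloring of the graph, measure for each color X on the vertices
   of that color and Z elsewhere.  This setting measures all stabilizer
   generators S_j with j of that color, so the range of its minimal test operator
   is fixed by them; as |G> is the only state fixed by all S_j, the average of the
   minimal tests has 1 as a simple eigenvalue.  Local complementation is
   implemented by a tensor product of single-qubit Clifford unitaries, which
   permute the three Pauli operators of each qubit up to sign and therefore carry
   a verifying set of settings for one graph state to one for the other, keeping
   its size and the number of Paulis used on each qubit. *)
Require Import Defs.
From mathcomp Require Import all_boot all_order all_algebra.
From mathcomp Require Import reals.
From mathcomp Require Import complex.
From mathcomp Require Import ring boolp.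

Set Implicit Arguments.
Unset Strict Implicit.
Unset Printing Implicit Defensive.
Import Order.TTheory GRing.Theory Num.Theory.
Local Open Scope ring_scope.
Local Open Scope sesquilinear_scope.

(** * Adjoints and positive semidefinite forms *)

Section Adjoint.
Variable C : numClosedFieldType.

Lemma adjointM m n p (A : 'M[C]_(m, n)) (B : 'M[C]_(n, p)) :
  (A *m B)^t* = B^t* *m A^t*.
Proof. by rewrite trmx_mul map_mxM. Qed.

Lemma adjoint1 n : (1%:M : 'M[C]_n)^t* = 1%:M.
Proof. by rewrite trmx1 map_mx1. Qed.

Lemma adjointZ m n a (A : 'M[C]_(m, n)) : (a *: A)^t* = a^* *: A^t*.
Proof. by rewrite linearZ /= map_mxZ. Qed.

Lemma adjointB m n (A B : 'M[C]_(m, n)) : (A - B)^t* = A^t* - B^t*.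
Proof. by rewrite linearB /= map_mxB. Qed.

Lemma adjoint_sum m n (I : finType) (P : pred I) (F : I -> 'M[C]_(m, n)) :
  (\sum_(i | P i) F i)^t* = \sum_(i | P i) (F i)^t*.
Proof. by rewrite linear_sum /= raddf_sum. Qed.

Lemma adjoint_mul_self_ge0 n (x : 'cV[C]_n) : 0 <= (x^t* *m x) 0 0.
Proof. by rewrite mxE sumr_ge0 // => i _; rewrite !mxE mulrC mul_conjC_ge0. Qed.

Lemma adjoint_mul_self_eq0 n (x : 'cV[C]_n) : (x^t* *m x) 0 0 = 0 -> x = 0.
Proof.
rewrite mxE => /eqP; rewrite psumr_eq0; last first.
  by move=> i _; rewrite !mxE mulrC mul_conjC_ge0.
move/allP => x0; apply/matrixP => i j; rewrite (ord1 j) mxE.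
by have := x0 i (mem_index_enum i); rewrite !mxE mulrC mul_conjC_eq0 => /eqP.
Qed.

(** For an orthogonal projector the form at x is the squared norm of A x. *)
Lemma psd_proj n (A : 'M[C]_n) : A^t* = A -> A *m A = A -> psd A.
Proof.
move=> Ah AA x; rewrite -AA mulmxA -mulmxA -[X in _ *m X *m _]Ah -adjointM.
exact: adjoint_mul_self_ge0.
Qed.

End Adjoint.

(** * Tensor products of single-qubit matrices *)

Section Tensor.
Variables (C : numClosedFieldType) (n : nat).
Implicit Types A B : 'I_n -> 'M[C]_2.

Lemma eq_tens A B : A =1 B -> tens A = tens B.
Proof.
by move=> AB; apply/matrixP => r c; rewrite !mxE; apply: eq_bigr => k _; rewrite AB.
Qed.

Lemma tensM A B : tens A *m tens B = tens (fun k => A k *m B k).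
Proof.
apply/matrixP => r c; rewrite !mxE.
under [RHS]eq_bigr do rewrite mxE.
(* A product over qubits of sums over bits expands into a sum over bit strings, which [enum_val]
   matches with the summation index of the matrix product. *)
rewrite bigA_distr_bigA /= (reindex (@enum_val _ {: bits n})) /=; last first.
  exact/onW_bij/enum_val_bij.
by apply: eq_bigr => m _; rewrite !mxE -big_split.
Qed.

Lemma tens1 : tens (fun=> 1%:M) = 1%:M :> 'M[C]_(qdim n).
Proof.
apply/matrixP => r c; rewrite !mxE.
under eq_bigr do rewrite mxE.
case: eqVneq => [->|rc]; first by rewrite big1 // => k _; rewrite eqxx.
have /existsP[k kP] :
    [exists k, (enum_val r : bits n) k != (enum_val c : bits n) k].
  rewrite -negb_forall; apply: contra rc => /forallP rc.
  by apply/eqP/enum_val_inj/ffunP => k; apply/eqP.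
by rewrite (bigD1 k) //= (negPf kP) mul0r.
Qed.

Lemma tens0 A k : A k = 0 -> tens A = 0.
Proof.
by move=> Ak; apply/matrixP => r c; rewrite !mxE (bigD1 k) //= Ak mxE mul0r.
Qed.

Lemma tensZ (a : 'I_n -> C) A :
  tens (fun k => a k *: A k) = (\prod_k a k) *: tens A.
Proof.
by apply/matrixP => r c; rewrite !mxE -big_split; apply: eq_bigr => k _; rewrite mxE.
Qed.

Lemma tens_adjoint A : (tens A)^t* = tens (fun k => (A k)^t*).
Proof.
apply/matrixP => r c; rewrite !mxE rmorph_prod.
by apply: eq_bigr => k _; rewrite !mxE.
Qed.

Lemma tens_sum (F : 'I_n -> 'I_2 -> 'M[C]_2) :
  \sum_(v : bits n) tens (fun k => F k (v k)) = tens (fun k => \sum_b F k b).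
Proof.
apply/matrixP => r c; rewrite summxE mxE.
under [RHS]eq_bigr do rewrite summxE.
by rewrite bigA_distr_bigA /=; apply: eq_bigr => v _; rewrite mxE.
Qed.

End Tensor.

(** * Pauli matrices, their projectors, and single-qubit Clifford gates *)

Section Pauli.
Variable C : numClosedFieldType.
Local Notation X := (pauli_mx C PX).
Local Notation Z := (pauli_mx C PZ).

Lemma matrix2P (A B : 'M[C]_2) : A 0 0 = B 0 0 -> A 0 1 = B 0 1 ->
  A 1 0 = B 1 0 -> A 1 1 = B 1 1 -> A = B.
Proof.
have ord2 (i : 'I_2) : i = 0 \/ i = 1.
  by case: i => [[|[|//]] ?]; [left | right]; apply: val_inj.
move=> h00 h01 h10 h11; apply/matrixP => i j.
by case: (ord2 i) => ->; case: (ord2 j) => ->.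
Qed.

Lemma mx2M (a b c d a' b' c' d' : C) : mx2 a b c d *m mx2 a' b' c' d' =
  mx2 (a * a' + b * c') (a * b' + b * d') (c * a' + d * c') (c * b' + d * d').
Proof.
by apply: matrix2P; rewrite !mxE big_ord_recl big_ord1 !mxE.
Qed.

Lemma mx2Z (x a b c d : C) :
  x *: mx2 a b c d = mx2 (x * a) (x * b) (x * c) (x * d).
Proof. by apply: matrix2P; rewrite !mxE. Qed.

Lemma mx2_adjoint (a b c d : C) : (mx2 a b c d)^t* = mx2 a^* c^* b^* d^*.
Proof. by apply: matrix2P; rewrite !mxE. Qed.

Lemma mx2_1 : 1%:M = mx2 1 0 0 1 :> 'M[C]_2.
Proof. by apply: matrix2P; rewrite !mxE. Qed.

Lemma mul_imaginary : 'i * 'i = -1 :> C.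
Proof. by rewrite -expr2 sqrCi. Qed.

Lemma mul_pauli_self P : pauli_mx C P *m pauli_mx C P = 1%:M.
Proof.
case: P; rewrite mx2M mx2_1; congr mx2;
  by ring: mul_imaginary.
Qed.


(** By the eigenvalue equation the product is (1 + (-1)^(b + b'))/2 times the second projector. *)
Lemma pauli_projM P b b' :
  pauli_proj C P b *m pauli_proj C P b' =
  if b == b' then pauli_proj C P b else 0.
Proof.
have [/(_ b') mulP _ _] := pauli_projP C P.
have two : (2 : C) != 0 by rewrite pnatr_eq0.
rewrite {1}/pauli_proj -scalemxAl mulmxDl mul1mx -scalemxAl mulP scalerA.
rewrite -{1}[pauli_proj C P b']scale1r -scalerDl scalerA.
case: eqVneq => [->|].
  by rewrite -expr2 sqrr_sign -mulr2n mulVf ?scale1r.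
by case: b => [[|[|//]] ?]; case: b' {mulP} => [[|[|//]] ?] //= _;
  rewrite expr0 expr1 ?mulr1 ?mul1r subrr mulr0 scale0r.
Qed.

Lemma mul_proj_pauli P b :
  pauli_proj C P b *m pauli_mx C P = (-1) ^+ b *: pauli_proj C P b.
Proof.
have [<- _ _] := pauli_projP C P.
by rewrite -scalemxAl -scalemxAr mulmxDl mulmxDr mul1mx mulmx1 -scalemxAl -scalemxAr.
Qed.

Definition swapXY P := match P with PX => PY | PY => PX | PZ => PZ end.
Definition swapYZ P := match P with PX => PX | PY => PZ | PZ => PY end.

(* Up to a phase, [exp(-i pi/4 Z)] and [exp(i pi/4 X)]; the phase of the second
   is chosen to avoid square roots. *)
Definition phase_gate : 'M[C]_2 := mx2 1 0 0 'i.
Definition sqrtX_gate : 'M[C]_2 :=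
  mx2 ((1 + 'i) / 2) (('i - 1) / 2) (('i - 1) / 2) ((1 + 'i) / 2).

(** The sign exponent lies in ['I_2] so that it can be added to an outcome bit. *)
Definition permutes_paulis (U : 'M[C]_2) (f : pauli -> pauli) : Prop :=
  exists s : pauli -> 'I_2,
  forall P, U *m pauli_mx C P *m U^t* = (-1) ^+ s P *: pauli_mx C (f P).

(** The intertwining form reduces the check for a concrete gate to products of explicit 2 by 2
    matrices, without adjoints. *)
Lemma permutes_paulisI (U : 'M[C]_2) f (s : pauli -> 'I_2) :
  U *m U^t* = 1%:M ->
  (forall P, U *m pauli_mx C P = (-1) ^+ s P *: (pauli_mx C (f P) *m U)) ->
  permutes_paulis U f.
Proof.
by move=> UU Us; exists s => P; rewrite Us -scalemxAl -mulmxA UU mulmx1.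
Qed.

Lemma phase_gate_unitary : phase_gate *m phase_gate^t* = 1%:M.
Proof.
rewrite mx2_adjoint mx2M mx2_1 rmorph1 rmorph0 conjCi.
by congr mx2; ring: mul_imaginary.
Qed.

Lemma sqrtX_gate_unitary : sqrtX_gate *m sqrtX_gate^t* = 1%:M.
Proof.
rewrite mx2_adjoint mx2M mx2_1 !fmorph_div /= rmorphD rmorphB /=.
rewrite rmorph1 conjCi rmorph_nat.
by congr mx2; field: mul_imaginary.
Qed.

Lemma phase_gate_permutes : permutes_paulis phase_gate swapXY.
Proof.
apply: (@permutes_paulisI _ _ (fun P => if P is PY then 1 else 0)).
  exact: phase_gate_unitary.
by case; rewrite /= !mx2M mx2Z; congr mx2; ring: mul_imaginary.
Qed.

Lemma sqrtX_gate_permutes : permutes_paulis sqrtX_gate swapYZ.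
Proof.
apply: (@permutes_paulisI _ _ (fun P => if P is PY then 1 else 0)).
  exact: sqrtX_gate_unitary.
by case; rewrite /= !mx2M mx2Z; congr mx2; field: mul_imaginary.
Qed.

Lemma id_permutes : permutes_paulis 1%:M id.
Proof.
exists (fun=> 0) => P.
by rewrite adjoint1 mulmx1 mul1mx expr0 scale1r.
Qed.

(** The matrix i X Z is Y, kept as a product in order to match the factors of two stabilizer
    generators. *)
Lemma phase_gateX :
  phase_gate *m X = 'i *: (X *m Z *m phase_gate).
Proof. by rewrite !mx2M mx2Z; congr mx2; ring: mul_imaginary. Qed.

Lemma phase_gateZ : phase_gate *m Z = Z *m phase_gate.
Proof. by rewrite !mx2M; congr mx2; ring: mul_imaginary. Qed.

Lemma sqrtX_gateX : sqrtX_gate *m X = X *m sqrtX_gate.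
Proof. by rewrite !mx2M; congr mx2; ring. Qed.

(** Again Y, now as -i Z X; this phase cancels the one of [phase_gateX]. *)
Lemma sqrtX_gateZ : sqrtX_gate *m Z = - 'i *: (Z *m X *m sqrtX_gate).
Proof. by rewrite !mx2M mx2Z; congr mx2; field: mul_imaginary. Qed.

(** The projector is affine in the Pauli matrix, so a sign acquired under conjugation amounts to a
    flip of the outcome. *)
Lemma pauli_proj_conj (U : 'M[C]_2) f : U *m U^t* = 1%:M ->
  permutes_paulis U f ->
  exists s : pauli -> 'I_2, forall P b,
    U *m pauli_proj C P b *m U^t* = pauli_proj C (f P) (b + s P).
Proof.
move=> UU [s Us]; exists s => P b.
rewrite /pauli_proj -scalemxAr -scalemxAl mulmxDr mulmxDl mulmx1 UU.
rewrite -scalemxAr -scalemxAl Us scalerA; congr (_ *: (_ + _ *: _)).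
by case: b => [[|[|//]] ?]; case: (s P) => [[|[|//]] ?] /=;
  rewrite ?expr0 ?expr1 ?mulrNN ?mul1r ?mulr1.
Qed.

End Pauli.

(** * Uniqueness of the state fixed by all stabilizer generators *)

Section Stabilizers.
Variables (C : numClosedFieldType) (n : nat).
Implicit Types (e : rel 'I_n) (psi x : 'cV[C]_(qdim n)).

Lemma prod_on_qubit (P : pred 'I_n) (A : 'M[C]_2) :
  \prod_(k < n | P k) on_qubit k A = tens (fun l => if P l then A else 1%:M).
Proof.
(* The induction runs along the list of qubits; without repetitions no qubit receives the factor A
   twice. *)
have H : uniq (index_enum 'I_n) by apply: index_enum_uniq.
transitivity (tens (fun l => if (l \in index_enum 'I_n) && P l then A else 1%:M));
  last by apply: eq_tens => l; rewrite mem_index_enum.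
elim: (index_enum _) H => [_|k s IH /= /andP[ks us]].
  by rewrite big_nil -[LHS]tens1.
rewrite big_cons IH //; case: ifP => Pk.
  rewrite -[LHS]/(_ *m _) tensM; apply: eq_tens => l; rewrite in_cons.
  by case: eqP => [->|]; rewrite ?(negPf ks) ?Pk ?mulmx1 ?mul1mx.
apply: eq_tens => l; rewrite in_cons.
by case: eqP => [->|]; rewrite ?Pk ?andbF.
Qed.

Definition stabilizer_factor e j k : 'M[C]_2 :=
  if k == j then pauli_mx C PX else if e j k then pauli_mx C PZ else 1%:M.

Lemma stabilizerE e j : irreflexive e ->
  stabilizer C e j = tens (stabilizer_factor e j).
Proof.
move=> e_irr; rewrite /stabilizer prod_on_qubit -[LHS]/(_ *m _) tensM.
apply: eq_tens => k; rewrite /stabilizer_factor.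
by case: eqP => [->|_]; rewrite ?e_irr ?mulmx1 ?mul1mx.
Qed.

Definition bit_flip (j : 'I_n) (s : bits n) : bits n :=
  [ffun k => if k == j then s k + 1 else s k].

(* [S_j] maps each basis vector to a multiple of the one with bit [j] flipped. *)
Lemma stabilized_flip0 e j x (s : bits n) : irreflexive e ->
  stabilizer C e j *m x = x -> x (enum_rank (bit_flip j s)) 0 = 0 ->
  x (enum_rank s) 0 = 0.
Proof.
move=> e_irr; rewrite stabilizerE // => Sx x0.
rewrite -Sx mxE big1 // => c _.
have [->|cs] := eqVneq c (enum_rank (bit_flip j s)); first by rewrite x0 mulr0.
have /existsP[k kP] :
    [exists k, (enum_val c : bits n) k != bit_flip j s k].
  rewrite -negb_forall; apply: contra cs => /forallP cs.
  by apply/eqP/enum_val_inj; rewrite enum_rankK; apply/ffunP => k; apply/eqP.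
rewrite mxE (bigD1 k) //= enum_rankK.
suff -> : stabilizer_factor e j k (s k) ((enum_val c : bits n) k) = 0.
  by rewrite !mul0r.
move: kP; rewrite ffunE /stabilizer_factor.
by case: (k == j); [|case: (e j k)];
  case: (s k) => [[|[|//]] ?]; case: ((enum_val c : bits n) k) => [[|[|//]] ?];
  rewrite !mxE.
Qed.

(** Every bit string is reached from the zero string by flips, so a vanishing coordinate there
    spreads to all others, by induction on the number of ones. *)
Lemma stabilized_eq0 e x : irreflexive e ->
  (forall j, stabilizer C e j *m x = x) ->
  x (enum_rank ([ffun=> 0] : bits n)) 0 = 0 -> x = 0.
Proof.
move=> e_irr Sx x0.
suff xs0 (m : nat) (s : bits n) :
    (#|[set k : 'I_n | s k == 1%R]| < m)%N -> x (enum_rank s) 0 = 0.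
  apply/matrixP => r z; rewrite (ord1 z) mxE -[r]enum_valK.
  exact: xs0 (ltnSn _).
elim: m s => // m IH s; rewrite ltnS => sm.
have [k /eqP sk|s0] := pickP [pred k : 'I_n | s k == 1]; last first.
  rewrite -[RHS]x0; congr (x (enum_rank _) 0); apply/ffunP => k; rewrite ffunE.
  by have /= := s0 k; case: (s k) => [[|[|//]] ?] //= _; apply: val_inj.
apply: (stabilized_flip0 e_irr (Sx k)); apply: IH; apply: leq_trans sm.
apply: proper_card; apply/properP; split.
  apply/subsetP => l; rewrite !inE ffunE.
  by case: (l =P k) => // ->; rewrite sk.
by exists k; rewrite !inE ?sk // ffunE eqxx sk.
Qed.

(** Subtracting from x the multiple of psi with the same coordinate at the zero string leaves a
    fixed vector that vanishes there, hence everywhere. *)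
Lemma stabilized_graph_state e psi x : irreflexive e ->
  is_graph_state e psi -> (forall j, stabilizer C e j *m x = x) ->
  exists a, x = a *: psi.
Proof.
move=> e_irr /andP[/eqP psi1 /forallP Spsi] Sx.
set z := enum_rank ([ffun=> 0] : bits n).
have psi0 : psi z 0 != 0.
  apply/eqP => /stabilized_eq0 p0.
  have psiE : psi = 0 by apply: (p0 e) => // j; apply/eqP.
  move/matrixP/(_ 0 0): psi1; rewrite psiE mulmx0 !mxE eqxx => /eqP.
  by rewrite eq_sym oner_eq0.
exists (x z 0 / psi z 0); apply/eqP; rewrite -subr_eq0; apply/eqP.
apply: (stabilized_eq0 e_irr) => [j|].
  by rewrite mulmxBr -scalemxAr Sx (eqP (Spsi j)).
by rewrite !mxE -/z mulfVK // subrr.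
Qed.

End Stabilizers.

(** * Second largest eigenvalue of a Hermitian matrix *)

Section Spectrum.
Variable C : numClosedFieldType.

Lemma char_poly_conj N (A U V : 'M[C]_N) : U *m V = 1%:M ->
  char_poly (U *m A *m V) = char_poly A.
Proof.
move=> UV; have UV' : map_mx polyC U *m map_mx polyC V = 1%:M.
  by rewrite -map_mxM UV map_mx1.
rewrite /char_poly.
have -> : char_poly_mx (U *m A *m V) =
    map_mx polyC U *m char_poly_mx A *m map_mx polyC V.
  rewrite /char_poly_mx mulmxBr mulmxBl !map_mxM scalar_mxC.
  by rewrite -[_%:M *m _ *m _]mulmxA UV' mulmx1.
by rewrite !det_mulmx mulrAC -det_mulmx UV' det1 mul1r.
Qed.

(** The spectral theorem gives an orthonormal eigenbasis with real eigenvalues, all at most 1. As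
    the fixed vectors lie on one line, the eigenvalue 1 occurs at most once. *)
Lemma second_eigenvalue_lt1 N (A : 'M[C]_N) (psi : 'cV[C]_N) : (1 < N)%N ->
  A^t* = A -> psd (1%:M - A) ->
  (forall x : 'cV_N, A *m x = x -> exists a, x = a *: psi) ->
  exists2 l, is_second_largest_eigenvalue A l & l < 1.
Proof.
move=> N1 Ah A1 Afix.
have herm : A \is hermsymmx.
  by apply/is_hermitianmxP; rewrite expr0 scale1r Ah.
have /orthomx_spectralP := hermitian_normalmx herm.
have /mxOverP dreal := hermitian_spectral_diag_real herm.
have := spectral_unitarymx A; have := spectral_unit A.
move: (spectralmx A) (spectral_diag A) dreal => P d dreal Punit Puni AE.
have PP : P *m P^t* = 1%:M by apply/unitarymxP.
have PV := invmx_unitary Puni.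
(* The columns of the adjoint of [P] are the orthonormal eigenvectors. *)
pose x i := P^t* *m delta_mx i (0 : 'I_1).
have xx i j : (x i)^t* *m x j = (i == j)%:R%:M.
  rewrite /x adjointM trmxCK mulmxA -[_ *m P *m _]mulmxA PP mulmx1.
  rewrite trmx_delta map_delta_mx mul_delta_mx_cond.
  by apply/matrixP => a b; rewrite mulmxnE !mxE !ord1 !eqxx.
have Ax i : A *m x i = d 0 i *: x i.
  rewrite AE PV /x !mulmxA -[_ *m P *m _]mulmxA PP mulmx1 -!mulmxA.
  rewrite scalemxAr; congr (_ *m _); apply/matrixP => a b.
  rewrite mul_diag_mx !mxE.
  by case: (eqVneq a i) => [->|]; rewrite ?mulr0.
have d1 i : d 0 i <= 1.
  have := A1 (x i); rewrite -mulmxA mulmxBl mul1mx Ax mulmxBr -scalemxAr xx eqxx.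
  by rewrite !mxE eqxx mulr1 subr_ge0.
have uniq1 i j : d 0 i = 1 -> d 0 j = 1 -> i = j.
  move=> di dj; apply/eqP; case: eqVneq => // /negPf ij.
  have [a xi] : exists a, x i = a *: psi by apply: Afix; rewrite Ax di scale1r.
  have [b xj] : exists b, x j = b *: psi by apply: Afix; rewrite Ax dj scale1r.
  have xii := xx i i; have xjj := xx j j; have xij := xx i j.
  (* Two orthonormal vectors cannot both be multiples of [psi]. *)
  move: xii xjj xij; rewrite xi xj !adjointZ -!scalemxAl -!scalemxAr !eqxx ij.
  set q := _ *m psi.
  move=> /matrixP/(_ 0 0); rewrite !mxE => h1.
  move=> /matrixP/(_ 0 0); rewrite !mxE => h2.
  move=> /matrixP/(_ 0 0); rewrite !mxE !eqxx => /eqP.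
  rewrite !mulf_eq0 => /or3P[]/eqP z.
  - by move/eqP: h1; rewrite z mul0r eq_sym oner_eq0.
  - by move/eqP: h2; rewrite z mul0r mulr0 eq_sym oner_eq0.
  - by move/eqP: h1; rewrite z !mulr0 eq_sym oner_eq0.
pose s := sort >=%R [seq d 0 i | i <- enum 'I_N].
have smem a : a \in s -> a \is Num.real /\ a <= 1.
  by rewrite mem_sort => /mapP[i _ ->].
(* The order of [C] is total only on the reals, so sorting relies on the eigenvalues being real. *)
have tot : {in s &, total >=%R}.
  move=> a b /smem[ar _] /smem[br _]; exact: real_leVge.
have ssize : size s = N by rewrite size_sort size_map size_enum_ord.
have ssorted : sorted >=%R s.
  apply: (@sort_sorted_in _ (mem s)); last first.
    by apply/allP => a ai; change (a \in s); rewrite mem_sort.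
  by move=> a b; apply: tot.
exists s`_1.
  exists s; split => //; last by rewrite ssize.
  rewrite (perm_big [seq d 0 i | i <- enum 'I_N]) ?perm_sort //=.
  rewrite AE char_poly_conj ?mulVmx // big_map big_enum.
  rewrite char_poly_trig; last by apply/is_diag_mx_is_trig/diag_mx_is_diag.
  by apply: eq_bigr => i _; rewrite mxE eqxx.
have s1 : s`_1 \in s by rewrite mem_nth ?ssize.
rewrite lt_neqAle (smem _ s1).2 andbT; apply/eqP => s11.
(* If the second entry is 1, so is the first by sortedness, and 1 is counted twice. *)
have s01 : s`_0 = 1.
  have s0 : s`_0 \in s by rewrite mem_nth // ssize; apply: ltnW.
  apply/eqP; rewrite eq_le (smem _ s0).2 /= -s11.
  by move: ssorted; case: (s) ssize N1 => [|a [|b t]] //= <- // _ /andP[].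
have : (count_mem 1%R s <= 1)%N.
  rewrite count_sort count_map enumT -size_filter.
  rewrite [size _](_ : _ = #|[pred i | d 0%R i == 1%R]|); last by rewrite cardE.
  by apply/card_le1_eqP => i j /eqP di /eqP dj; apply: uniq1.
case: (s) ssize N1 s01 s11 => [|a [|b t]] /= <- // _ -> ->.
by rewrite eqxx.
Qed.

End Spectrum.

(** * Minimal tests, and verifying settings from colorings *)

Section Verification.
Variables (C : numClosedFieldType) (n : nat).
Implicit Types (e : rel 'I_n) (psi x : 'cV[C]_(qdim n)) (mu : setting n).
Implicit Types (M : {set setting n}).

Lemma outcome_projM mu (v w : bits n) :
  outcome_proj C mu v *m outcome_proj C mu w =
  if v == w then outcome_proj C mu v else 0.
Proof.
rewrite tensM; case: eqVneq => [->|vw].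
  by apply: eq_tens => k; rewrite pauli_projM eqxx.
have /existsP[k /negPf kP] : [exists k, v k != w k].
  rewrite -negb_forall; apply: contra vw => /forallP vw.
  by apply/eqP/ffunP => k; apply/eqP.
by apply: (tens0 (k := k)); rewrite pauli_projM kP.
Qed.

Lemma outcome_proj_adjoint mu (v : bits n) :
  (outcome_proj C mu v)^t* = outcome_proj C mu v.
Proof.
rewrite tens_adjoint; apply: eq_tens => k.
by have [_ -> _] := pauli_projP C (mu k).
Qed.

Lemma sum_outcome_proj mu : \sum_v outcome_proj C mu v = 1%:M.
Proof.
rewrite (tens_sum (fun k b => pauli_proj C (mu k) b)) -[RHS]tens1; apply: eq_tens => k.
by have [_ _ ->] := pauli_projP C (mu k).
Qed.

(* The smallest test operator based on [mu]: every test operator for [psi] has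
   coefficient 1 on these outcomes. *)
Definition min_test psi mu : 'M[C]_(qdim n) :=
  \sum_(v | outcome_proj C mu v *m psi != 0) outcome_proj C mu v.

Lemma min_test_adjoint psi mu : (min_test psi mu)^t* = min_test psi mu.
Proof.
by rewrite adjoint_sum; apply: eq_bigr => v _; rewrite outcome_proj_adjoint.
Qed.

Lemma min_test_idem psi mu : min_test psi mu *m min_test psi mu = min_test psi mu.
Proof.
rewrite mulmx_suml; apply: eq_bigr => v Pv.
rewrite mulmx_sumr (bigD1 v) //= outcome_projM eqxx big1 ?addr0 // => w.
by case/andP=> _ /negPf wv; rewrite outcome_projM eq_sym wv.
Qed.

(** It is an orthogonal projector, as is its complement, and the omitted outcomes annihilate psi, so
    by completeness it fixes psi. *)
Lemma min_test_operator psi mu : test_operator psi mu (min_test psi mu).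
Proof.
split.
- by apply: psd_proj; [apply: min_test_adjoint | apply: min_test_idem].
- apply: psd_proj; first by rewrite adjointB adjoint1 min_test_adjoint.
  by rewrite mulmxBl mul1mx mulmxBr mulmx1 min_test_idem subrr subr0.
- rewrite -[RHS]mul1mx -(sum_outcome_proj mu) /min_test !mulmx_suml [RHS]big_mkcond.
  rewrite [LHS]big_mkcond; apply: eq_bigr => v _ /=.
  by case: eqP.
- exists (fun v => (outcome_proj C mu v *m psi != 0)%:R).
  rewrite /min_test big_mkcond; apply: eq_bigr => v _ /=.
  by case: (_ != _); rewrite ?scale1r ?scale0r.
Qed.

Lemma min_test_fixed psi mu x :
  (x^t* *m (1%:M - min_test psi mu) *m x) 0 0 = 0 -> min_test psi mu *m x = x.
Proof.
set F := 1%:M - _.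
have Fh : F^t* = F by rewrite adjointB adjoint1 min_test_adjoint.
have FF : F *m F = F.
  by rewrite mulmxBl mul1mx mulmxBr mulmx1 min_test_idem subrr subr0.
rewrite -FF mulmxA -mulmxA -[X in _ *m X *m _]Fh -adjointM => /adjoint_mul_self_eq0.
by rewrite mulmxBl mul1mx => /eqP; rewrite subr_eq0 => /eqP.
Qed.

(** The tests are mixed uniformly. For a vector fixed by the mixture, a positive combination of the
    nonnegative forms of the complements vanishes, so each test fixes it. *)
Lemma can_verify_min_test psi M : (0 < n)%N -> (0 < #|M|)%N ->
  (forall x, (forall mu, mu \in M -> min_test psi mu *m x = x) ->
     exists a, x = a *: psi) ->
  can_verify_state psi M.
Proof.
move=> n0 M0 fixM.
have MC0 : #|M|%:R != 0 :> C by rewrite pnatr_eq0 -lt0n.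
pose p : setting n -> C := fun=> #|M|%:R^-1.
have p1 : \sum_(mu in M) p mu = 1 by rewrite sumr_const -[LHS]mulr_natr mulVf.
have p0 mu : 0 < p mu by rewrite invr_gt0 ltr0n.
pose Om := \sum_(mu in M) p mu *: min_test psi mu.
have OmE x : (x^t* *m (1%:M - Om) *m x) 0 0 =
    \sum_(mu in M) p mu * (x^t* *m (1%:M - min_test psi mu) *m x) 0 0.
  have -> : 1%:M - Om = \sum_(mu in M) p mu *: (1%:M - min_test psi mu).
    under [RHS]eq_bigr do rewrite scalerBr.
    by rewrite sumrB -scaler_suml p1 scale1r.
  rewrite mulmx_sumr mulmx_suml summxE.
  by apply: eq_bigr => mu _; rewrite -scalemxAr -scalemxAl mxE.
have psdF mu x : 0 <= (x^t* *m (1%:M - min_test psi mu) *m x) 0 0.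
  by have [_ + _ _] := min_test_operator psi mu; apply.
have [l l2 l1] : exists2 l, is_second_largest_eigenvalue Om l & l < 1.
  apply: (second_eigenvalue_lt1 (psi := psi)).
  (* With at least one qubit the dimension exceeds 1, so a second eigenvalue exists. *)
  - by rewrite card_ffun !card_ord -(expn0 2) ltn_exp2l.
  - rewrite adjoint_sum; apply: eq_bigr => mu _.
    by rewrite adjointZ min_test_adjoint conj_Creal // gtr0_real.
  - move=> x; rewrite OmE sumr_ge0 // => mu _; rewrite mulr_ge0 //.
    exact: ltW.
  move=> x Omx; apply: fixM => mu muM; apply: min_test_fixed.
  have : (x^t* *m (1%:M - Om) *m x) 0 0 = 0.
    by rewrite -mulmxA mulmxBl mul1mx Omx subrr mulmx0 mxE.
  move/eqP; rewrite OmE psumr_eq0 => [/allP/(_ mu)|nu _]; last first.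
    by rewrite mulr_ge0 // ltW.
  by rewrite mem_index_enum muM mulf_eq0 gt_eqF //= => /(_ isT)/eqP.
exists p, (min_test psi), l; split => // mu _; first exact: ltW.
exact: min_test_operator.
Qed.

(** On each outcome projector S_j acts from either side as one sign; if the outcome does not
    annihilate psi, then S_j psi = psi forces this sign to be +1. *)
Lemma stabilizer_min_test e psi mu j : irreflexive e -> is_graph_state e psi ->
  mu j = PX -> (forall k, e j k -> mu k = PZ) ->
  stabilizer C e j *m min_test psi mu = min_test psi mu.
Proof.
move=> e_irr /andP[_ /forallP/(_ j)/eqP Spsi] muj muk.
rewrite mulmx_sumr; apply: eq_bigr => v vpsi.
pose sg k : C := if (k == j) || e j k then (-1) ^+ (v k) else 1.
have SP : stabilizer C e j *m outcome_proj C mu v =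
    (\prod_k sg k) *: outcome_proj C mu v.
  rewrite stabilizerE // tensM -tensZ; apply: eq_tens => k.
  rewrite /stabilizer_factor /sg; have [h _ _] := pauli_projP C (mu k).
  case: eqP h => [->|_] /=; first by rewrite muj.
  by case: ifP => [/muk ->//|_]; rewrite mul1mx scale1r.
have PS : outcome_proj C mu v *m stabilizer C e j =
    (\prod_k sg k) *: outcome_proj C mu v.
  rewrite stabilizerE // tensM -tensZ; apply: eq_tens => k.
  rewrite /stabilizer_factor /sg; have h := mul_proj_pauli C (mu k).
  case: eqP h => [->|_] /=; first by rewrite muj.
  by case: ifP => [/muk ->//|_]; rewrite mulmx1 scale1r.
rewrite SP; suff -> : \prod_k sg k = 1 by rewrite scale1r.
have : (\prod_k sg k - 1) *: (outcome_proj C mu v *m psi) = 0.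
  by rewrite scalerBl scale1r scalemxAl -PS -mulmxA Spsi subrr.
by move/eqP; rewrite scaler_eq0 (negPf vpsi) orbF subr_eq0 => /eqP.
Qed.

Lemma coloring_can_verify e psi k : (0 < n)%N -> irreflexive e ->
  is_graph_state e psi -> colorable e k ->
  exists M, [/\ can_verify_state psi M, two_paulis_per_qubit M & (#|M| <= k)%N].
Proof.
move=> n0 e_irr psiG [c cP].
pose mu_ (i : 'I_k) : setting n := [ffun j => if c j == i then PX else PZ].
exists (mu_ @: setT); split.
- apply: can_verify_min_test => //.
    by apply/card_gt0P; exists (mu_ (c (Ordinal n0))); apply: imset_f.
  move=> x xM; apply: (stabilized_graph_state e_irr psiG) => j.
  have xj : min_test psi (mu_ (c j)) *m x = x by apply/xM/imset_f.
  rewrite -xj mulmxA stabilizer_min_test // => [|l jl]; rewrite ffunE ?eqxx //.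
  by rewrite eq_sym (negPf (cP _ _ jl)).
- apply/forallP => j; apply: (@leq_trans #|[set PX; PZ]|).
    by apply: subset_leq_card; apply/subsetP => P /imsetP[_ /imsetP[i _ ->] ->];
      rewrite ffunE !inE; case: ifP => _; rewrite eqxx ?orbT.
  by rewrite cards2; case: (_ != _).
- by apply: leq_trans (leq_imset_card _ _) _; rewrite cardsT card_ord.
Qed.

(** Makes verification independent of the phase chosen for the graph state. *)
Lemma can_verify_stateZ psi M a : can_verify_state psi M ->
  can_verify_state (a *: psi) M.
Proof.
case=> [p [E [l [p0 p1 tE El l1]]]]; exists p, E, l; split => // mu /tE [E0 E1 Epsi Ec].
by split => //; rewrite -scalemxAr Epsi.
Qed.

End Verification.

(** * Transport of verification along local Clifford unitaries *)

Section LocalClifford.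
Variables (C : numClosedFieldType) (n : nat).
Variables (U : 'I_n -> 'M[C]_2) (f : 'I_n -> pauli -> pauli).
Hypotheses (U_unitary : forall k, U k *m (U k)^t* = 1%:M)
  (U_permutes : forall k, permutes_paulis (U k) (f k))
  (f_involutive : forall k, involutive (f k)).
Local Notation V := (tens U).

Definition conj_setting (mu : setting n) : setting n := [ffun k => f k (mu k)].

Lemma conj_settingK : involutive conj_setting.
Proof. by move=> mu; apply/ffunP => k; rewrite !ffunE f_involutive. Qed.

Lemma tens_unitary : V *m V^t* = 1%:M.
Proof.
by rewrite tens_adjoint tensM -[RHS]tens1; apply: eq_tens => k; apply: U_unitary.
Qed.

Lemma tens_unitaryK m (x : 'M[C]_(_, m)) : V^t* *m (V *m x) = x.
Proof. by rewrite mulmxA (mulmx1C tens_unitary) mul1mx. Qed.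

Lemma psd_conj (A : 'M[C]_(qdim n)) : psd A -> psd (V *m A *m V^t*).
Proof.
by move=> A0 x; have := A0 (V^t* *m x); rewrite adjointM trmxCK !mulmxA.
Qed.

(** For a given setting the signs of the qubits flip a fixed set of outcome bits. *)
Lemma outcome_proj_conj (mu : setting n) : exists2 t : bits n -> bits n,
  involutive t & forall v, V *m outcome_proj C mu v *m V^t* =
                           outcome_proj C (conj_setting mu) (t v).
Proof.
have /fin_all_exists[s sP] k : exists s : pauli -> 'I_2, forall P b,
    U k *m pauli_proj C P b *m (U k)^t* = pauli_proj C (f k P) (b + s P).
  exact: pauli_proj_conj.
exists (fun v => [ffun k => v k + s k (mu k)]).
  move=> v; apply/ffunP => k; rewrite !ffunE -addrA.
  suff -> (b : 'I_2) : b + b = 0 by rewrite addr0.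
  by case: b => [[|[|//]] ?]; apply: val_inj.
by move=> v; rewrite tens_adjoint !tensM; apply: eq_tens => k; rewrite sP !ffunE.
Qed.

Lemma test_operator_conj psi mu E : test_operator psi mu E ->
  test_operator (V *m psi) (conj_setting mu) (V *m E *m V^t*).
Proof.
case=> E0 E1 Epsi [c Ec]; split.
- exact: psd_conj.
- have -> : 1%:M - V *m E *m V^t* = V *m (1%:M - E) *m V^t*.
    by rewrite mulmxBr mulmxBl mulmx1 tens_unitary.
  exact: psd_conj.
- by rewrite -!mulmxA tens_unitaryK Epsi.
- have [t tK tP] := outcome_proj_conj mu.
  exists (c \o t); rewrite (reindex_inj (inv_inj tK)) Ec mulmx_sumr mulmx_suml.
  by apply: eq_bigr => v _; rewrite /= tK -scalemxAr -scalemxAl tP.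
Qed.

(** The mixture of the tests is conjugated by a unitary, which preserves its characteristic
    polynomial. *)
Lemma can_verify_state_conj psi M : can_verify_state psi M ->
  can_verify_state (V *m psi) (conj_setting @: M).
Proof.
case=> [p [E [l [p0 p1 tE El l1]]]].
have inj := inv_inj conj_settingK.
(* As [conj_setting] is its own inverse, it recovers the original setting. *)
exists (p \o conj_setting), (fun mu => V *m E (conj_setting mu) *m V^t*), l.
split => //.
- by move=> _ /imsetP[mu /p0 ? ->]; rewrite /= conj_settingK.
- rewrite big_imset /=; last exact: in2W.
  by rewrite -p1; apply: eq_bigr => mu _; rewrite conj_settingK.
- move=> _ /imsetP[mu /tE muE ->]; rewrite conj_settingK.
  exact: test_operator_conj.
rewrite big_imset /=; last exact: in2W.
rewrite (_ : \sum_(mu in M) _ = V *m (\sum_(mu in M) p mu *: E mu) *m V^t*).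
  case: El => s [sE ? ? ?]; exists s; split => //.
  by rewrite char_poly_conj // tens_unitary.
rewrite mulmx_sumr mulmx_suml; apply: eq_bigr => mu _.
by rewrite !conj_settingK -scalemxAr -scalemxAl.
Qed.

Lemma two_paulis_conj (M : {set setting n}) :
  two_paulis_per_qubit M -> two_paulis_per_qubit (conj_setting @: M).
Proof.
move=> /forallP M2; apply/forallP => j; apply: leq_trans (M2 j).
have -> : [set (mu : setting n) j | mu in conj_setting @: M] =
    f j @: [set (mu : setting n) j | mu in M].
  by rewrite -!imset_comp; apply: eq_imset => mu /=; rewrite ffunE.
exact: leq_imset_card.
Qed.

End LocalClifford.

(** * Graph states under local complementation *)

Section LocalComplementation.
Variables (C : numClosedFieldType) (n : nat).
Implicit Types (e : rel 'I_n) (j k : 'I_n).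

Lemma local_compl_sym e j : symmetric e -> symmetric (local_compl e j).
Proof.
by move=> e_sym u v; rewrite /local_compl eq_sym (e_sym u v) [e j u && _]andbC.
Qed.

Lemma local_compl_irr e j : irreflexive e -> irreflexive (local_compl e j).
Proof. by move=> e_irr u; rewrite /local_compl eqxx e_irr. Qed.

(** Up to phase, a square root of X on [j] and of Z on each neighbor: the unitary that implements
    complementation at [j]. *)
Definition lc_gate e j k : 'M[C]_2 :=
  if k == j then sqrtX_gate C else if e j k then phase_gate C else 1%:M.

Definition lc_perm e j k : pauli -> pauli :=
  if k == j then swapYZ else if e j k then swapXY else id.

Lemma lc_gate_unitary e j k : lc_gate e j k *m (lc_gate e j k)^t* = 1%:M.
Proof.
rewrite /lc_gate; case: ifP => _; first exact: sqrtX_gate_unitary.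
by case: ifP => _; rewrite ?phase_gate_unitary // adjoint1 mulmx1.
Qed.

Lemma lc_gate_permutes e j k : permutes_paulis (lc_gate e j k) (lc_perm e j k).
Proof.
rewrite /lc_gate /lc_perm; case: ifP => _; first exact: sqrtX_gate_permutes.
by case: ifP => _; [apply: phase_gate_permutes | apply: id_permutes].
Qed.

Lemma lc_perm_involutive e j k : involutive (lc_perm e j k).
Proof. by rewrite /lc_perm; case: ifP => _; [|case: ifP => _]; case. Qed.

(** A vertex not adjacent to [j], such as [j] itself, keeps its neighborhood, and on every qubit its
    stabilizer factor commutes with the gate. *)
Lemma stabilizer_lc_far e j k : symmetric e -> irreflexive e -> ~~ e j k ->
  stabilizer C e k *m tens (lc_gate e j) =
  tens (lc_gate e j) *m stabilizer C (local_compl e j) k.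
Proof.
move=> e_sym e_irr /negPf jk.
rewrite !stabilizerE ?tensM //; last exact: local_compl_irr.
apply: eq_tens => l; rewrite /stabilizer_factor /local_compl jk andbF /lc_gate.
have [->|lk] := eqVneq l k.
  by rewrite jk; case: eqP => _; rewrite ?mul1mx ?mulmx1 ?sqrtX_gateX.
have [->|_] := eqVneq l j; first by rewrite e_sym jk mul1mx mulmx1.
case: (e j l); case: (e k l); rewrite ?mul1mx ?mulmx1 //.
by rewrite phase_gateZ.
Qed.

(* Conjugation turns [X_k Z_j] into [Y_k Y_j], which is a product of two
   stabilizer generators of [e]. *)
Lemma stabilizer_lc_near e j k : symmetric e -> irreflexive e -> e j k ->
  stabilizer C e k *m (stabilizer C e j *m tens (lc_gate e j)) =
  tens (lc_gate e j) *m stabilizer C (local_compl e j) k.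
Proof.
move=> e_sym e_irr jk; have /negPf kj : k != j.
  by apply: contraTneq jk => ->; rewrite e_irr.
rewrite !stabilizerE ?tensM //; last exact: local_compl_irr.
(* The phases in Y = i X Z on [k] and Y = -i Z X on [j], with product 1. *)
pose a l : C := if l == k then 'i else if l == j then - 'i else 1.
have a1 : \prod_l a l = 1.
  rewrite (bigD1 k) //= (bigD1 j) /=; last by rewrite eq_sym kj.
  rewrite big1 => [|l /andP[/negPf lk /negPf lj]]; last by rewrite /a lk lj.
  by rewrite /a eqxx eq_sym kj eqxx mulr1 mulrN mul_imaginary opprK.
rewrite -[LHS]scale1r -a1 -tensZ; apply: eq_tens => l.
rewrite /stabilizer_factor /local_compl jk /lc_gate /a.
have [->|lk] := eqVneq l k; first by rewrite kj jk phase_gateX mulmxA.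
have [->|lj] := eqVneq l j.
  by rewrite e_irr andbF e_sym jk sqrtX_gateZ mulmxA.
(* On the other qubits the factor Z of S_j toggles that of S_k exactly at the neighbors of [j],
   which is the complementation. *)
rewrite scale1r; case: (e j l); case: (e k l); rewrite ?mul1mx ?mulmx1 //.
- by rewrite mulmxA mul_pauli_self mul1mx.
- by rewrite phase_gateZ.
Qed.

Lemma graph_state_lc e j psi : symmetric e -> irreflexive e ->
  is_graph_state (local_compl e j) psi ->
  is_graph_state e (tens (lc_gate e j) *m psi).
Proof.
move=> e_sym e_irr /andP[/eqP psi1 /forallP Spsi]; apply/andP; split.
  by rewrite adjointM -mulmxA tens_unitaryK ?psi1 //; apply: lc_gate_unitary.
have far k : ~~ e j k ->
    stabilizer C e k *m (tens (lc_gate e j) *m psi) = tens (lc_gate e j) *m psi.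
  by move=> jk; rewrite mulmxA stabilizer_lc_far // -mulmxA (eqP (Spsi k)).
apply/forallP => k; apply/eqP; have [jk|/far//] := boolP (e j k).
(* S_j fixes the vector, as [j] is not its own neighbor, so it can be inserted after a generator S_k
   with [k] adjacent to [j]. *)
rewrite -[in LHS](far j) ?e_irr // mulmxA mulmxA -[_ *m _ *m tens _]mulmxA.
by rewrite stabilizer_lc_near // -mulmxA (eqP (Spsi k)).
Qed.

(** The state is left existential so that gates can move it without tracking its phase. *)
Definition verifiable e m := exists psi : 'cV[C]_(qdim n), exists M,
  [/\ is_graph_state e psi, can_verify_state psi M, two_paulis_per_qubit M &
      (#|M| <= m)%N].

Lemma verifiable_lc e j m : symmetric e -> irreflexive e ->
  verifiable (local_compl e j) m -> verifiable e m.
Proof.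
move=> e_sym e_irr [psi [M [psiG psiM M2 Mm]]].
exists (tens (lc_gate e j) *m psi), (conj_setting (lc_perm e j) @: M); split.
- exact: graph_state_lc.
- apply: can_verify_state_conj => //; first exact: lc_gate_unitary.
    exact: lc_gate_permutes.
  exact: lc_perm_involutive.
- exact: two_paulis_conj.
- exact: leq_trans (leq_imset_card _ _) Mm.
Qed.

Lemma verifiable_lcs e s m : (0 < n)%N -> symmetric e -> irreflexive e ->
  colorable (foldl (@local_compl n) e s) m -> verifiable e m.
Proof.
move=> n0; elim: s e => [|j s IH] e e_sym e_irr /= em.
  have [psi psiG] := graph_state_exists C e_sym e_irr.
  have [M [? ? ?]] := coloring_can_verify n0 e_irr psiG em.
  by exists psi, M.
apply: (verifiable_lc (j := j)) => //; apply: IH => //.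
  exact: local_compl_sym.
exact: local_compl_irr.
Qed.

End LocalComplementation.

(** * Existence of the minima and the chain of inequalities *)

Lemma ex_minimum (P : nat -> Prop) m : P m -> exists k, is_minimum P k.
Proof.
move=> Pm; have exP : exists k, `[< P k >] by exists m; apply/asboolP.
case: (ex_minnP exP) => k /asboolP Pk kmin; exists k; split => // l /asboolP.
exact: kmin.
Qed.

Theorem proposition6 (R : realType) (n : nat) (n_gt0 : (0 < n)%N)
    (e : rel 'I_n) (e_sym : symmetric e) (e_irr : irreflexive e) :
  exists chit chit2 chiLC chi : nat,
    [/\ is_chi_tilde R[i] e_sym e_irr chit,
        is_chi_tilde2 R[i] e_sym e_irr chit2,
        is_chi_LC e chiLC &
        is_chromatic_number e chi] /\
    (chit <= chit2 <= chiLC)%N /\ (chiLC <= chi)%N.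
Proof.
have [chi chiP] : exists chi, is_chromatic_number e chi.
  (* Giving each vertex its own color is proper. *)
  apply: (ex_minimum (m := n)); exists id => u v uv.
  by apply: contraTneq uv => ->; rewrite e_irr.
have [chiLC chiLCP] : exists k, is_chi_LC e k.
  by apply: (ex_minimum (m := chi)); exists [::].
have [[s [sLC _]] chiLC_min] := chiLCP.
have [psi [M [psiG psiM M2 Mm]]] := verifiable_lcs R[i] n_gt0 e_sym e_irr sLC.
(* The chosen graph state is a multiple of [psi], so [M] verifies it as well. *)
have eM : can_verify R[i] e_sym e_irr M.
  have /andP[_ /forallP Spsi] := graph_stateP R[i] e_sym e_irr.
  have [a aE] := stabilized_graph_state e_irr psiG (fun j => eqP (Spsi j)).
  by rewrite /can_verify aE; apply: can_verify_stateZ.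
have [chit2 chit2P] : exists k, is_chi_tilde2 R[i] e_sym e_irr k.
  by apply: (ex_minimum (m := #|M|)); exists M.
have [[M' [eM' M'2] M'E] chit2_min] := chit2P.
have [chit chitP] : exists k, is_chi_tilde R[i] e_sym e_irr k.
  by apply: (ex_minimum (m := chit2)); exists M'.
have [_ chit_min] := chitP.
(* The empty sequence of local complementations gives the last inequality. *)
exists chit, chit2, chiLC, chi; split => //; split; last by apply: chiLC_min; exists [::].
rewrite chit_min /=; last by exists M'.
by apply: leq_trans Mm; apply: chit2_min; exists M.
Qed.
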